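(* Let $\mathbb{F}_q$ be a finite field and let $\mathcal{P}(\vec\lambda)=\mathcal{P}(\lambda_0,\dots,\lambda_N)$ be the $N$-dimensional weighted projective stack with positive integer weights such that $\mathrm{char}(\mathbb{F}_q)\nmid\lambda_i$ for every $i$, and put $|\vec\lambda|:=\sum_{i=0}^N\lambda_i$. Let $\mathrm{Hom}_n(\mathbb{P}^1,\mathcal{P}(\vec\lambda))$ be the Hom stack of degree $n\ge 1$ morphisms from $\mathbb{P}^1$ to $\mathcal{P}(\vec\lambda)$. Then the weighted point count of $\mathrm{Hom}_n(\mathbb{P}^1,\mathcal{P}(\vec\lambda))$ over $\mathbb{F}_q$ equals $$\#_q\left(\mathrm{Hom}_n(\mathbb{P}^1,\mathcal{P}(\vec\lambda))\right)=\left(\sum_{i=0}^N q^i\right)\cdot\left(q^{|\vec\lambda|n}-q^{|\vec\lambda|n-N}\right)=q^{|\vec\lambda|n-N}\cdot\left(q^{2N}+\dots+q^{N+1}-q^{N-1}-\dots-1\right).$$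
   Context: The weighted projective stack is $\mathcal{P}(\vec\lambda)=[(\mathbb{A}^{N+1}\setminus 0)/\mathbb{G}_m]$, where $\zeta\cdot(x_0,\dots,x_N)=(\zeta^{\lambda_0}x_0,\dots,\zeta^{\lambda_N}x_N)$; $\mathcal{O}_{\mathcal{P}(\vec\lambda)}(1)$ is the dual of the tautological line bundle, and $x_i$ is a section of $\mathcal{O}_{\mathcal{P}(\vec\lambda)}(\lambda_i)$. $\mathrm{Hom}_n(\mathbb{P}^1,\mathcal{P}(\vec\lambda))$ is the (Deligne–Mumford) stack of morphisms $f:\mathbb{P}^1\to\mathcal{P}(\vec\lambda)$ with $f^*\mathcal{O}_{\mathcal{P}(\vec\lambda)}(1)$ of degree $n$. Equivalently, it parameterizes tuples $(s_0,\dots,s_N)$, $s_i\in H^0(\mathbb{P}^1,\mathcal{O}(n\lambda_i))$, without common zeroes, modulo $\mathbb{G}_m$ acting on the $i$-th entry with weight $\lambda_i$. The weighted point count of an algebraic stack $\mathcal{X}$ of finite type over $\mathbb{F}_q$ is $\#_q(\mathcal{X}):=\sum_{x\in\mathcal{X}(\mathbb{F}_q)/\sim}\frac1{|\mathrm{Aut}(x)|}$, the sum over $\mathbb{F}_q$-isomorphism classes of $\mathbb{F}_q$-points, where $\frac{1}{|\mathrm{Aut}(x)|}=0$ if $|\mathrm{Aut}(x)|=\infty$. *)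

(* Defs.v *)
From HB Require Import structures.
From mathcomp Require Import all_boot all_order all_algebra.
From mathcomp Require Import finmap.
From mathcomp Require Import all_classical all_reals all_analysis.

Set Implicit Arguments.
Unset Strict Implicit.
Unset Printing Implicit Defensive.

Import Order.TTheory GRing.Theory Num.Theory.

Local Open Scope classical_set_scope.
Local Open Scope ring_scope.

(* Arrows live in a common type [gmor], cut out by [ghom x y]; composition is
   in diagrammatic order. *)
Record groupoid := Groupoid {
  gob : Type;
  gmor : choiceType;
  ghom : gob -> gob -> set gmor;
  gid : gob -> gmor;
  gcomp : gmor -> gmor -> gmor;
  ginv : gmor -> gmor;
  gidP : forall x, ghom x x (gid x);
  gcompP : forall x y z f g,
    ghom x y f -> ghom y z g -> ghom x z (gcomp f g);
  ginvP : forall x y f, ghom x y f -> ghom y x (ginv f);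
  gcompA : forall x y z t f g h, ghom x y f -> ghom y z g -> ghom z t h ->
    gcomp f (gcomp g h) = gcomp (gcomp f g) h;
  gcompil : forall x y f, ghom x y f -> gcomp (gid x) f = f;
  gcompir : forall x y f, ghom x y f -> gcomp f (gid y) = f;
  gcompVl : forall x y f, ghom x y f -> gcomp (ginv f) f = gid y;
  gcompVr : forall x y f, ghom x y f -> gcomp f (ginv f) = gid x
}.

Section WeightedCount.
Variables (R : realType) (G : groupoid).

Definition iso_class (x : gob G) : set (gob G) :=
  [set y | exists f, ghom x y f].

(* The set of all isomorphism classes. *)
Definition iso_classes : set (set (gob G)) := range iso_class.

Definition aut (x : gob G) : set (gmor G) := ghom x x.

(* 1 / |Aut(x)|, which is 0 when Aut(x) is infinite. *)
Definition aut_weight (x : gob G) : R :=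
  if pselect (finite_set (aut x)) then (#|` fset_set (aut x)|%:R)^-1 else 0.

(* The weight of a class, read off on a chosen representative; it does not
   depend on the choice since isomorphic objects have conjugate automorphism
   groups.  The second branch is never reached on [iso_classes]. *)
Definition class_weight (C : set (gob G)) : R :=
  match pselect (exists x, C x) with
  | left Cn0 => aut_weight (projT1 (cid Cn0))
  | right _ => 0
  end.

(* An unconditional sum of nonnegative terms: it is +oo if it diverges. *)
Definition weighted_count : \bar R :=
  \esum_(C in iso_classes) (class_weight C)%:E.

End WeightedCount.

(* P^1 over F is glued from U_0 = Spec F[t] and U_1 = Spec F[u] along u = 1/t;
   everything on the overlap Spec F[t, 1/t] is computed in F(t). *)
Section ProjectiveLine.
Variable F : fieldType.
Implicit Types (a b p r : {poly F}) (g : {fraction {poly F}}).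

Definition ratX : {fraction {poly F}} := tofrac 'X.

(* Restrictions to the overlap of a function a(t) on U_0 and of a function
   b(u) on U_1, the latter becoming b(1/t). *)
Definition res0 a : {fraction {poly F}} := tofrac a.
Definition res1 b : {fraction {poly F}} :=
  (map_poly (@tofrac {poly F} \o polyC) b).[ratX^-1].

(* Membership in F[t, 1/t]. *)
Definition regular_on_overlap g :=
  exists a k, g = res0 a / ratX ^+ k.

(* A line bundle on P^1 restricts to trivial bundles on U_0 and U_1, as F[t]
   and F[u] are principal, so it is given by a transition function, a unit g
   of F[t, 1/t]: a section is a pair (a(t), b(u)) with a(t) = g * b(1/t).
   The tensor power L^m has transition function g ^+ m. *)
Record line_bundle := LineBundle {
  transition : {fraction {poly F}};
  transition_neq0 : transition != 0;
  transition_regular : regular_on_overlap transition;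
  transitionV_regular : regular_on_overlap transition^-1
}.

(* The rational section of L equal to 1 on U_1 is g on U_0; g being a unit
   away from t = 0, the degree of L is the order of vanishing of g at t = 0. *)
Definition has_degree (L : line_bundle) (d : int) :=
  exists p r, [/\ p.[0] != 0, r.[0] != 0 &
    transition L = ratX ^ d * (res0 p / res0 r)].

Definition is_section_pow (L : line_bundle) (m : nat) a b :=
  res0 a = transition L ^+ m * res1 b.

End ProjectiveLine.

(* An F-point of Hom_n(P^1, P(lambda)) is a morphism from P^1 over F to
   [(A^{N+1} \ 0) / G_m], that is, a G_m-torsor with an equivariant map to
   A^{N+1} \ 0; equivalently, a line bundle L = f^* O(1) with sections
   s_i = f^* x_i of L^{lambda_i} that have no common zero at any geometric
   point. The section s_i is ([coord0 i], [coord1 i]) on U_0 and U_1. *)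
Section HomStack.
Variables (F : fieldType) (N : nat) (lam : 'I_N.+1 -> nat) (n : nat).

Definition no_common_zero (s : 'I_N.+1 -> {poly F}) : Prop :=
  forall (K : fieldType) (phi : {rmorphism F -> K}) (x : K),
    exists i, (map_poly phi (s i)).[x] != 0.

Record hom_point := HomPoint {
  bundle : line_bundle F;
  coord0 : 'I_N.+1 -> {poly F};
  coord1 : 'I_N.+1 -> {poly F};
  bundle_degree : has_degree bundle n%:Z;
  coord_glue : forall i, is_section_pow bundle (lam i) (coord0 i) (coord1 i);
  coord0_nz : no_common_zero coord0;
  coord1_nz : no_common_zero coord1
}.

(* An isomorphism is an isomorphism of line bundles, multiplication by units
   m.1 of F[t] and m.2 of F[u] compatible with the transition functions, whose
   lambda_i-th power carries s_i to s'_i. *)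
Definition hom_iso (x y : hom_point) : set ({poly F} * {poly F}) :=
  [set m | [/\ m.1 \is a GRing.unit, m.2 \is a GRing.unit,
    res0 m.1 * transition (bundle x) = transition (bundle y) * res1 m.2,
    (forall i, coord0 y i = m.1 ^+ lam i * coord0 x i) &
    (forall i, coord1 y i = m.2 ^+ lam i * coord1 x i)]].

Lemma res1M (a b : {poly F}) : res1 (a * b) = res1 a * res1 b.
Proof. by rewrite /res1 rmorphM hornerM. Qed.

Lemma res1_1 : res1 (1 : {poly F}) = 1.
Proof. by rewrite /res1 rmorph1 hornerC. Qed.

Lemma hom_iso1 x : hom_iso x x (1, 1).
Proof.
split=> [||/=|i|i] /=; rewrite ?unitr1 ?expr1n ?mul1r //.
by rewrite res1_1 mulr1.
Qed.

Lemma hom_isoM x y z f g : hom_iso x y f -> hom_iso y z g ->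
  hom_iso x z (g.1 * f.1, g.2 * f.2).
Proof.
move=> [uf1 uf2 ef f0 f1] [ug1 ug2 eg g0 g1]; split=> [||/=|i|i].
- by rewrite unitrM ug1.
- by rewrite unitrM ug2.
- rewrite res1M /res0 rmorphM -mulrA -!/(res0 _) ef mulrA eg.
  by rewrite mulrA.
- by rewrite g0 f0 mulrA exprMn.
- by rewrite g1 f1 mulrA exprMn.
Qed.

Lemma hom_isoV x y f : hom_iso x y f -> hom_iso y x (f.1^-1, f.2^-1).
Proof.
move=> [u1 u2 e e0 e1]; split=> [||/=|i|i]; rewrite ?unitrV //.
- have r0 : res0 f.1^-1 * res0 f.1 = 1 by rewrite /res0 -rmorphM mulVr // rmorph1.
  have r1 : res1 f.2 * res1 f.2^-1 = 1 by rewrite -res1M mulrV // res1_1.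
  rewrite -[transition (bundle y)]mulr1 -r1 [transition (bundle y) * _]mulrA -e.
  by rewrite !mulrA r0 mul1r.
- by rewrite e0 mulrA -exprMn mulVr // expr1n mul1r.
- by rewrite e1 mulrA -exprMn mulVr // expr1n mul1r.
Qed.

(* The groupoid of F-points of Hom_n(P^1, P(lambda)). *)
Definition Hom_stack_points : groupoid.
Proof.
refine (@Groupoid hom_point ({poly F} * {poly F})%type hom_iso
  (fun=> (1, 1)) (fun f g => (g.1 * f.1, g.2 * f.2))
  (fun f => (f.1^-1, f.2^-1)) hom_iso1 hom_isoM hom_isoV _ _ _ _ _).
- by move=> x y z t f g h _ _ _ /=; rewrite !mulrA.
- by move=> x y [a b] _ /=; rewrite !mulr1.
- by move=> x y [a b] _ /=; rewrite !mul1r.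
- by move=> x y [a b] [/= ua ub _ _ _]; rewrite !mulrV.
- by move=> x y [a b] [/= ua ub _ _ _]; rewrite !mulVr.
Defined.

End HomStack.

(* Main.v *)
Require Import Defs.
From HB Require Import structures.
From mathcomp Require Import all_boot all_order all_algebra.
From mathcomp Require Import all_fingroup all_field.
From mathcomp Require Import finmap zify ring.
From mathcomp Require Import all_classical all_reals all_analysis.
Import Order.TTheory GRing.Theory Num.Theory.
Local Open Scope ring_scope.

(** A line bundle of degree n on the projective line has transition function
    c t^n, so it is isomorphic to O(n), and a section of its lambda_i-th power
    is a polynomial of degree at most d_i = n lambda_i together with its
    reversal ([degree_transition], [section_revp]).  An isomorphism is a pair
    of nonzero constants, the second determined by the first and by the two
    transition functions.  Hence the groupoid of F_q-points is equivalent to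
    the action groupoid of F_q^* acting with weights lambda_i on the set X of
    tuples (a_i) of polynomials with deg a_i <= d_i, with gcd 1, and with
    deg a_i = d_i for some i ([iso_unit_bij], [coords_surj]).  The last
    condition says that infinity is not a common zero.  By the orbit-stabilizer
    theorem the weighted count of an action groupoid is the cardinality of
    the set divided by that of the group, so the answer is |X| / (q - 1)
    ([weighted_count_quotient]).

    Only |X| remains.  Let M(e) be the number of tuples with gcd 1 and with
    size a_i <= e_i, the size of a nonzero polynomial being its degree plus
    one.  Multiplying a nonzero tuple by (g X + x) / g, where g is its monic
    gcd and x a constant, produces each nonzero tuple with nontrivial gcd
    exactly once, and raises the sizes of the nonzero entries by one.  So
    there are q (q^(sum (e_i - 1)) - 1) such tuples, which gives M(e)
    ([card_coprime_bounded]) with neither Moebius inversion nor a summation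
    over the possible gcds.  Finally |X| = M(d + 1) - M(d), that is, with
    W = sum d_i,
      |X| = q^(W + N + 1) - q^(W + 1) - q^W + q^(W - N)
          = (q^(N + 1) - 1) (q^W - q^(W - N)). *)

Set Implicit Arguments.
Unset Strict Implicit.
Unset Printing Implicit Defensive.

(** * The gcd of a finite family of polynomials *)

Section TupleGcd.
Variables (F : fieldType) (I : finType).
Implicit Types (s c : I -> {poly F}) (d g h : {poly F}).

Definition gcds s : {poly F} := \big[@gcdp F/0]_i s i.

(** [gcdp] is only canonical up to a constant; the monic normalization turns
    association into equality.  The gcd of the zero family stays 0. *)
Definition mgcd s : {poly F} := (lead_coef (gcds s))^-1 *: gcds s.

Lemma mgcd_eqp s : mgcd s %= gcds s.
Proof.
rewrite /mgcd; have [->|nz] := eqVneq (gcds s) 0.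
  by rewrite scaler0 eqpxx.
by rewrite eqp_scale // invr_eq0 lead_coef_eq0.
Qed.

(** This universal property determines the gcd. *)
Lemma dvdp_mgcd d s : (d %| mgcd s) = [forall i, d %| s i].
Proof.
rewrite (eqp_dvdr _ (mgcd_eqp s)) /gcds.
transitivity (all (fun i => d %| s i) (index_enum I)).
  by elim: index_enum => [|i r IH]; rewrite ?big_nil ?big_cons ?dvdp0 //= dvdp_gcd IH.
apply/allP/forallP => [H i|H i _]; last exact: H.
by apply: H; rewrite mem_index_enum.
Qed.

Lemma mgcd_dvdp s i : mgcd s %| s i.
Proof. by have := dvdpp (mgcd s); rewrite dvdp_mgcd => /forallP. Qed.

Lemma mgcd_eq0 s : (mgcd s == 0) = [forall i, s i == 0].
Proof.
by rewrite -dvd0p dvdp_mgcd; apply: eq_forallb => i; rewrite dvd0p.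
Qed.

Lemma mgcd_monic s : mgcd s != 0 -> mgcd s \is monic.
Proof.
move=> nz; rewrite monicE lead_coefZ mulVf // lead_coef_eq0.
by apply: contraNneq nz => s0; rewrite /mgcd s0 scaler0.
Qed.

Lemma eq_mgcd s c : s =1 c -> mgcd s = mgcd c.
Proof.
by move=> sc; rewrite /mgcd /gcds; under eq_bigr do rewrite sc.
Qed.

(** Multiplying a family by a monic polynomial multiplies its gcd by it, without
    any correcting constant. *)
Lemma mgcdMl h c : h \is monic -> mgcd (fun i => h * c i) = h * mgcd c.
Proof.
move=> hm; have [c0|cn0] := eqVneq (mgcd c) 0.
  rewrite c0 mulr0; apply/eqP; rewrite mgcd_eq0.
  move/eqP: c0; rewrite mgcd_eq0 => /forallP c0.
  by apply/forallP => i; rewrite (eqP (c0 i)) mulr0.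
have hn0 := monic_neq0 hm.
have mn0 : mgcd (fun i => h * c i) != 0.
  apply: contraNneq cn0 => /eqP; rewrite !mgcd_eq0 => /forallP c0.
  by apply/forallP => i; have := c0 i; rewrite mulf_eq0 (negPf hn0).
apply/eqP; rewrite -eqp_monic ?monicMl ?mgcd_monic // ?monicMl ?mgcd_monic //.
rewrite (eqp_trans (mgcd_eqp _)) //.
apply: (@eqp_trans _ (h * gcds c)); last first.
  by rewrite eqp_mul2l // eqp_sym mgcd_eqp.
rewrite /gcds; elim: index_enum => [|i r IH]; first by rewrite !big_nil mulr0 eqpxx.
rewrite !big_cons (eqp_trans (eqp_gcdr _ IH)) // eqp_sym.
exact: mulp_gcdr.
Qed.

Lemma mgcd_div s : mgcd s != 0 -> mgcd (fun i => s i %/ mgcd s) = 1.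
Proof.
move=> nz; apply: (mulfI nz); rewrite mulr1 -mgcdMl ?mgcd_monic //.
by apply: eq_mgcd => i; rewrite mulrC divpK ?mgcd_dvdp.
Qed.

Lemma eqp_mgcd s c : (forall i, s i %= c i) -> mgcd s = mgcd c.
Proof.
move=> sc; have E : mgcd s %= mgcd c.
  apply/andP; split; rewrite dvdp_mgcd; apply/forallP => i.
    by rewrite -(eqp_dvdr _ (sc i)) mgcd_dvdp.
  by rewrite (eqp_dvdr _ (sc i)) mgcd_dvdp.
have [c0|cn0] := eqVneq (mgcd c) 0; first by move: E; rewrite c0 eqp0 => /eqP.
apply/eqP; rewrite -eqp_monic ?mgcd_monic //.
by apply: contraNneq cn0 => s0; move: E; rewrite s0 eqp_sym eqp0.
Qed.

End TupleGcd.

(** * Counting coprime families of bounded size *)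

Section CountCoprime.
Variables (F : finFieldType) (I : finType) (D : nat).
Implicit Types (a b : {ffun I -> {poly_D F}}) (e : I -> nat).

Local Notation ztuple := ([ffun=> 0] : {ffun I -> {poly_D F}}).

(** Families live in a finite type by imposing a common bound D on all sizes;
    the bounds e of interest are below D. *)
Definition bounded e : {set {ffun I -> {poly_D F}}} :=
  [set a : {ffun I -> {poly_D F}} | [forall i, (size (a i) <= e i)%N]].

Definition gcdt a : {poly F} := mgcd (fun i => val (a i)).

Definition coprime_bounded e := [set a in bounded e | gcdt a == 1].

Lemma card_small_poly m : (m <= D)%N ->
  #|[pred p : {poly_D F} | (size p <= m)%N]| = (#|F| ^ m)%N.
Proof.
move=> mD; rewrite -(card_npoly F m).
have inj : injective (fun p : {poly_m F} => npolyp D p).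
  move=> p r /(congr1 (@polyn _ _)); rewrite !npolypK ?(leq_trans (size_npoly _)) //.
  exact: val_inj.
rewrite -(card_imset _ inj); apply: eq_card => p; rewrite !inE.
apply/idP/imsetP => [sp|[r _ ->]]; last by rewrite npolypK ?(leq_trans (size_npoly _)).
exists (npolyp m p) => //; apply: val_inj => /=.
by rewrite !npolypK ?size_npoly.
Qed.

Lemma card_bounded e : (forall i, e i <= D)%N ->
  #|bounded e| = (#|F| ^ \sum_i e i)%N.
Proof.
move=> eD; rewrite expn_sum.
transitivity #|family (fun i => [pred p : {poly_D F} | (size p <= e i)%N])|.
  by apply: eq_card => a; rewrite !inE; apply: eq_forallb => i; rewrite !inE.
rewrite card_family foldrE big_map big_enum /=.
by apply: eq_bigr => i _; rewrite card_small_poly.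
Qed.

Lemma gcdt_eq0 a : (gcdt a == 0) = (a == ztuple).
Proof.
rewrite mgcd_eq0; apply/forallP/eqP => [H|-> i]; last by rewrite ffunE.
by apply/ffunP => i; rewrite ffunE; apply: val_inj; apply/eqP/H.
Qed.

(** Every monic polynomial of degree k + 1 is g * 'X + x for exactly one monic g
    of degree k and one constant x.  Replacing the gcd g by g * 'X + x is the
    bijection behind [card_not_coprime]. *)
Definition shift_gcd (ax : {ffun I -> {poly_D F}} * F) : {ffun I -> {poly_D F}} :=
  [ffun i => npolyp D
     ((gcdt ax.1 * 'X + ax.2%:P) * (val (ax.1 i) %/ gcdt ax.1))].

Lemma size_monicMX_addC (g : {poly F}) x : g != 0 ->
  size (g * 'X + x%:P) = (size g).+1.
Proof. by move=> g0; rewrite size_MXaddC (negPf g0). Qed.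

Lemma monicMX_addC (g : {poly F}) x : g \is monic -> g * 'X + x%:P \is monic.
Proof.
move=> gm; rewrite monicE lead_coefDl ?lead_coefMX ?(monicP gm) //.
rewrite size_mulX ?monic_neq0 // ltnS (leq_trans (size_polyC_leq1 _)) //.
by rewrite size_poly_gt0 monic_neq0.
Qed.

Lemma shift_gcdE e a x i : (forall j, e j <= D)%N -> a \in bounded (fun j => (e j).-1) ->
  gcdt a != 0 ->
  (size (shift_gcd (a, x) i) <= e i)%N /\
  shift_gcd (a, x) i = (gcdt a * 'X + x%:P) * (val (a i) %/ gcdt a) :> {poly F}.
Proof.
move=> eD; rewrite inE => /forallP ab g0.
suff sz : (size ((gcdt a * 'X + x%:P) * (val (a i) %/ gcdt a))%R <= e i)%N.
  by rewrite ffunE npolypK // (leq_trans sz).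
have [a0|an0] := eqVneq (val (a i)) 0; first by rewrite a0 div0p mulr0 size_poly0.
rewrite (leq_trans (size_polyMleq _ _)) // size_monicMX_addC // size_divp //=.
have := ab i; have := dvdp_leq an0 (mgcd_dvdp (fun i => val (a i)) i).
have : (0 < size (gcdt a))%N by rewrite size_poly_gt0.
have : (0 < size (a i))%N by rewrite size_poly_gt0.
rewrite -/(gcdt a) /=; move: (size (a i)) (size (gcdt a)) (e i) => u v w; lia.
Qed.

(** Dividing by the gcd leaves a coprime family, so the factor put back is the
    new gcd; this is what makes [shift_gcd] injective. *)
Lemma gcdt_shift e a x : (forall j, e j <= D)%N -> a \in bounded (fun j => (e j).-1) ->
  gcdt a != 0 -> gcdt (shift_gcd (a, x)) = gcdt a * 'X + x%:P.
Proof.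
move=> eD ab g0; rewrite /gcdt.
rewrite (eq_mgcd (fun i => (shift_gcdE x i eD ab g0).2)) mgcdMl.
  by rewrite mgcd_div // mulr1.
by rewrite monicMX_addC // mgcd_monic.
Qed.

(** [shift_gcd] is a bijection from the pairs of a nonzero family bounded by
    e - 1 and a constant onto this set. *)
Lemma card_not_coprime e : (forall j, e j <= D)%N ->
  #|[set a in bounded e | (a != ztuple) && (gcdt a != 1)]| =
  ((#|bounded (fun j => (e j).-1)|).-1 * #|F|)%N.
Proof.
move=> eD; pose B := bounded (fun j => (e j).-1) :\ ztuple.
have B0 : (#|bounded (fun j => (e j).-1)|).-1 = #|B|.
  rewrite (cardsD1 ztuple) inE; case: forallP => // -[] i.
  by rewrite ffunE size_poly0.
have BP ax : ax \in finset.setX B [set: F] ->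
    ax.1 \in bounded (fun j => (e j).-1) /\ gcdt ax.1 != 0.
  by rewrite !inE gcdt_eq0 => /andP[/andP[]].
rewrite B0 -finset.cardsT -finset.cardsX -(card_in_imset (f := shift_gcd)); last first.
  (* The gcds of the images determine g and x; the quotients then agree too. *)
  move=> [a x] [b y] /BP [/= ab a0] /BP [/= bb b0] E.
  have := congr1 gcdt E; rewrite (gcdt_shift _ eD ab a0) (gcdt_shift _ eD bb b0) => Eg.
  have xy : x = y.
    by have /(congr1 (fun p : {poly F} => p.[0])) := Eg; rewrite !hornerMXaddC !mulr0 !add0r.
  have gab : gcdt a = gcdt b.
    by move/eqP: Eg; rewrite xy (inj_eq (addIr _)) (inj_eq (mulIf _)) ?polyX_eq0 // => /eqP.
  congr (_, _) => //; apply/ffunP => i; apply: val_inj => /=.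
  rewrite -[LHS](divpK (mgcd_dvdp (fun i => val (a i)) i)).
  rewrite -[RHS](divpK (mgcd_dvdp (fun i => val (b i)) i)) -!/(gcdt _) gab.
  congr (_ * _); have := congr1 (fun f : {ffun I -> {poly_D F}} => val (f i)) E.
  rewrite /= (shift_gcdE x i eD ab a0).2 (shift_gcdE y i eD bb b0).2 -xy gab => /mulfI; apply.
  by rewrite -size_poly_eq0 size_monicMX_addC.
apply: eq_card => b; rewrite [LHS]inE.
apply/idP/imsetP => [/and3P[bb b0 b1]|[[a x] /BP[/= ab a0] ->]]; last first.
  have := gcdt_shift x eD ab a0 => Eg; rewrite -gcdt_eq0 Eg -size_poly_eq0.
  rewrite size_monicMX_addC //= andbC; apply/andP; split.
    apply/negP => /eqP /(congr1 (fun p : {poly F} => size p)).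
    rewrite size_monicMX_addC // size_poly1 => -[]/eqP.
    by rewrite size_poly_eq0 (negPf a0).
  by rewrite inE; apply/forallP => i; case: (shift_gcdE x i eD ab a0).
have g0 : gcdt b != 0 by rewrite gcdt_eq0.
have gm : gcdt b \is monic by rewrite mgcd_monic.
have cop := mgcd_div g0; rewrite -/(gcdt b) in cop.
(* The preimage of b is read off from its gcd written as g * 'X + x. *)
have [g [x Eg]] : exists g x, gcdt b = g * 'X + x%:P.
  by elim/poly_ind: (gcdt b) => [|g x _]; [exists 0, 0; rewrite mul0r addr0|exists g, x].
have gn0 : g != 0.
  apply: contraNneq b1 => g_eq0; move: gm; rewrite Eg g_eq0 mul0r add0r monicE lead_coefC.
  by move/eqP->.
have gmon : g \is monic.
  move: gm; rewrite !monicE Eg lead_coefDl ?lead_coefMX // size_mulX //.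
  by rewrite ltnS (leq_trans (size_polyC_leq1 _)) // size_poly_gt0.
have sz i : (size (g * (val (b i) %/ gcdt b))%R <= (e i).-1)%N.
  have [z|nz] := eqVneq (val (b i)) 0; first by rewrite z div0p mulr0 size_poly0.
  rewrite size_monicM // ?dvdp_div_eq0 ?mgcd_dvdp //.
  move: bb; rewrite inE => /forallP/(_ i); rewrite /= size_divp //.
  have := dvdp_leq nz (mgcd_dvdp (fun i => val (b i)) i); rewrite -/(gcdt b).
  rewrite Eg size_monicMX_addC //=.
  by move: (size (b i)) (size g) (e i) => u v w; lia.
pose a := [ffun i => npolyp D (g * (val (b i) %/ gcdt b))].
have aE i : a i = g * (val (b i) %/ gcdt b) :> {poly F}.
  by rewrite ffunE npolypK // (leq_trans (sz i)) // (leq_trans (leq_pred _)).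
have ga : gcdt a = g by rewrite /gcdt (eq_mgcd aE) mgcdMl // cop mulr1.
have ab : a \in bounded (fun j => (e j).-1).
  by rewrite inE; apply/forallP => i; rewrite aE.
have an0 : gcdt a != 0 by rewrite ga.
exists (a, x); first by rewrite finset.in_setX finset.in_setD1 finset.in_setT -gcdt_eq0 an0 ab.
apply/ffunP => i; apply: val_inj; rewrite /= (shift_gcdE x i eD ab an0).2.
by rewrite ga -Eg (aE i : val (a i) = _) [g * _]mulrC mulpK // mulrC divpK // mgcd_dvdp.
Qed.

(** A family of bounded size is zero, coprime, or nonzero with a nontrivial gcd:
    the summand 1 on the left is the zero family. *)
Lemma card_coprime_bounded e : (forall j, e j <= D)%N ->
  (#|coprime_bounded e| + (#|F| ^ (\sum_i (e i).-1)).-1 * #|F| + 1 = #|F| ^ (\sum_i e i))%N.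
Proof.
move=> eD; rewrite -(card_bounded eD).
rewrite -card_bounded => [|i]; last by rewrite (leq_trans (leq_pred _)).
rewrite -card_not_coprime // [RHS](cardsD1 ztuple).
have -> : (ztuple \in bounded e) = true.
  by rewrite inE; apply/forallP => i; rewrite ffunE size_poly0.
rewrite [RHS]addnC; congr (_ + _)%N.
rewrite -(cardsID [set a | gcdt a == 1] (bounded e :\ ztuple)); congr (_ + _)%N.
  apply: eq_card => a; rewrite !inE -gcdt_eq0.
  by case: eqP => [->|_]; rewrite ?andbF // oner_eq0 /= andbT.
by apply: eq_card => a; rewrite !inE; case: (_ == _); rewrite ?andbF ?andbT //= andbC.
Qed.

End CountCoprime.

(** * Common zeros *)

(** The Euclidean algorithm does not see field extensions. *)
Lemma map_mgcd (F K : fieldType) (phi : {rmorphism F -> K}) (I : finType)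
    (s : I -> {poly F}) :
  map_poly phi (mgcd s) = mgcd (fun i => map_poly phi (s i)).
Proof.
have E : map_poly phi (gcds s) = gcds (fun i => map_poly phi (s i)).
  rewrite /gcds; elim: index_enum => [|i r IH]; first by rewrite !big_nil rmorph0.
  by rewrite !big_cons gcdp_map IH.
by rewrite /mgcd map_polyZ E fmorphV -E lead_coef_map.
Qed.

(** A nonconstant gcd acquires a root in an algebraic closure, and the roots of
    the gcd are the common roots in every extension. *)
Lemma no_common_zeroP (F : countFieldType) (N : nat) (s : 'I_N.+1 -> {poly F}) :
  no_common_zero s <-> mgcd s = 1.
Proof.
have root_mgcd (K : fieldType) (phi : {rmorphism F -> K}) x :
    root (map_poly phi (mgcd s)) x = [forall i, root (map_poly phi (s i)) x].
  rewrite -dvdp_XsubCl map_mgcd dvdp_mgcd.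
  by apply: eq_forallb => i; rewrite dvdp_XsubCl.
split=> [H|s1 K phi x].
  have [K [phi _]] := countable_algebraic_closure F.
  have sz : size (map_poly phi (mgcd s)) == 1.
    apply: contraT => /closed_rootP[x]; rewrite root_mgcd => /forallP sx.
    by have [i] := H K phi x; rewrite -[_ == 0]/(root _ x) sx.
  have m0 : mgcd s != 0.
    by rewrite -size_poly_eq0 -(size_map_poly phi) (eqP sz).
  rewrite size_map_poly in sz.
  apply/eqP; rewrite -eqp_monic ?monic1 ?mgcd_monic //.
  by rewrite -size_poly_eq1.
apply/existsP; rewrite -negb_forall -root_mgcd s1 rmorph1.
by rewrite rootE hornerC oner_eq0.
Qed.

(** * Sections of line bundles on the projective line *)

(** In this lemma and the next, t is meant to be the coordinate and g a
    transition function, given by its local expressions. *)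
Lemma mul_cleared (K : fieldType) (t g A B : K) k l :
  g != 0 -> t != 0 -> g = A / t ^+ k -> g^-1 = B / t ^+ l -> A * B = t ^+ (k + l).
Proof.
move=> g0 t0 gA gB; have k0 : t ^+ k != 0 by exact: expf_neq0.
have l0 : t ^+ l != 0 by exact: expf_neq0.
by rewrite -[A](divfK k0) -gA -[B](divfK l0) -gB mulrACA mulfV // mul1r exprD.
Qed.

Lemma cross_cleared (K : fieldType) (t g A p r : K) k d :
  r != 0 -> t != 0 -> g = A / t ^+ k -> g = t ^ d%:Z * (p / r) ->
  A * r = t ^+ (d + k) * p.
Proof.
move=> r0 t0 gA gE; have k0 : t ^+ k != 0 by exact: expf_neq0.
by rewrite -[A](divfK k0) -gA gE -exprnP exprD; field.
Qed.

Section ProjectiveLineSections.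
Variable F : fieldType.
Implicit Types (a b : {poly F}) (c : F) (d : nat).

(** The polynomial X^d a(1/X), for a of degree at most d. *)
Definition revp d a : {poly F} := \poly_(i < d.+1) a`_(d - i).

Lemma coef_revp d a i : (revp d a)`_i = if (i <= d)%N then a`_(d - i) else 0.
Proof. by rewrite coef_poly ltnS. Qed.

Lemma ratX_neq0 : ratX F != 0.
Proof. by rewrite tofrac_eq0 polyX_eq0. Qed.

Lemma res0_inj : injective (@res0 F).
Proof. by move=> a b /eqP; rewrite tofrac_eq => /eqP. Qed.

Lemma res0M a b : res0 (a * b) = res0 a * res0 b.
Proof. exact: rmorphM. Qed.

Lemma res0Xn m : res0 ('X^m : {poly F}) = ratX F ^+ m.
Proof. exact: rmorphXn. Qed.

Lemma res1C c : res1 c%:P = res0 c%:P.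
Proof. by rewrite /res1 map_polyC hornerC. Qed.

Lemma res1_revp d a : (size a <= d.+1)%N -> ratX F ^+ d * res1 a = res0 (revp d a).
Proof.
move=> sa; rewrite /res1 (@horner_coef_wide _ d.+1); last by rewrite (leq_trans (size_poly _ _)).
rewrite mulr_sumr (reindex_inj rev_ord_inj) /= /res0 /revp poly_def rmorph_sum.
apply: eq_bigr => i _ /=; rewrite coef_map /= -mul_polyC rmorphM rmorphXn /= subSS.
rewrite mulrCA; congr (_ * _).
rewrite -[in X in X * _](subnK (ltn_ord i : (i <= d)%N)) exprD mulrC mulrA.
by rewrite -exprMn mulVf ?ratX_neq0 // expr1n mul1r.
Qed.

(** A section of the bundle with transition function c t^d is a polynomial of
    degree at most d on one chart, and its rescaled reversal on the other. *)
Lemma section_revp d c a b : c != 0 ->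
  res0 a = res0 c%:P * ratX F ^+ d * res1 b <->
  (size a <= d.+1)%N /\ b = c^-1 *: revp d a.
Proof.
move=> c0; split=> [E|[sa ->]]; last first.
  rewrite -mulrA res1_revp; last first.
    by rewrite (leq_trans (size_scale_leq _ _)) // size_poly.
  rewrite /res0 -rmorphM; congr tofrac; apply/polyP => i.
  rewrite coefCM coef_revp; case: leqP => id; last first.
    by rewrite mulr0 nth_default // (leq_trans sa).
  by rewrite coefZ coef_revp leq_subr subKn // mulVKf.
(* The degree of b has no bound yet, so the denominators of b(1/t) are cleared
   with t^e for some e that is large enough. *)
pose e := maxn d (size b).
have de : (d <= e)%N by rewrite leq_maxl.
have be : (size b <= e.+1)%N by rewrite (leq_trans (leq_maxr d _)).
have {}E : 'X^(e - d) * a = c%:P * revp e b.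
  apply: res0_inj; rewrite !res0M -res1_revp // E res0Xn.
  rewrite !mulrA; congr (_ * _).
  by rewrite mulrAC -exprD subnK // mulrC.
have coefE i : (if (i < e - d)%N then 0 else a`_(i - (e - d))) =
    c * (if (i <= e)%N then b`_(e - i) else 0).
  by have /(congr1 (fun p : {poly F} => p`_i)) := E; rewrite coefXnM coefCM coef_revp.
split.
  apply/leq_sizeP => j dj; have := coefE (j + (e - d))%N.
  rewrite addnK ltnNge leq_addl /= => ->.
  by rewrite leqNgt (_ : (e < _)%N) /= ?mulr0 //; lia.
apply/polyP => k; rewrite coefZ coef_revp; apply: (mulfI c0); rewrite mulVKf //.
case: (leqP k e) => ke; last first.
  rewrite nth_default ?mulr0; last by rewrite (leq_trans be).
  by rewrite leqNgt (leq_ltn_trans de ke).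
have := coefE (e - k)%N; rewrite leq_subr subKn // => <-.
case: (leqP k d) => kd; last by rewrite (_ : (e - k < e - d)%N) //; lia.
rewrite ltnNge leq_sub2l //=; congr (_`_ _); lia.
Qed.

(** The units of F[t, 1/t] are the c t^d.  Here a / t^k and its inverse b / t^l
    give a * b = t^(k + l), and the degree forces a = a' t^(d + k) with
    a'(0) <> 0; such an a' divides a power of t, hence is constant. *)
Lemma degree_transition (L : line_bundle F) d : has_degree L d%:Z ->
  exists2 c, c != 0 & transition L = res0 c%:P * ratX F ^+ d.
Proof.
move=> [p [r [p0 r0 gE]]]; have [a [k ga]] := transition_regular L.
have [b [l gb]] := transitionV_regular L.
have nzr : r != 0 by apply: contraNneq r0 => ->; rewrite horner0.
have rn0 : res0 r != 0 by rewrite tofrac_eq0.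
have ab : a * b = 'X^(k + l).
  apply: res0_inj; rewrite res0M res0Xn.
  exact: mul_cleared (transition_neq0 L) ratX_neq0 ga gb.
have ar : a * r = 'X^(d + k) * p.
  apply: res0_inj; rewrite !res0M res0Xn.
  exact: cross_cleared rn0 ratX_neq0 ga gE.
have copX (q : {poly F}) m : q.[0] != 0 -> coprimep q 'X^m.
  by move=> q0; rewrite coprimep_expr // -[X in coprimep _ X]subr0 coprimep_XsubC.
have [a' aE] : exists a', a = a' * 'X^(d + k).
  apply/dvdpP; rewrite -(@Gauss_dvdpl _ a r) ?ar ?dvdp_mulr //.
  by rewrite coprimep_sym copX.
have a'0 : a'.[0] != 0.
  apply: contraNneq p0 => a'0.
  have : a' * r = p.
    apply: (mulfI (x := 'X^(d + k))); first by rewrite monic_neq0 ?monicXn.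
    by rewrite -ar aE mulrCA mulrA.
  by move<-; rewrite hornerM a'0 mul0r.
have : size a' == 1%N.
  rewrite -coprimepp; apply: (coprimep_dvdl _ (copX a' (k + l)%N a'0)).
  by rewrite -ab aE -mulrA dvdp_mulr.
move/size_poly1P => [c c0 a'E]; exists c => //.
by rewrite ga aE a'E res0M res0Xn exprD mulrA; exact: mulfK (expf_neq0 k ratX_neq0) _.
Qed.

Lemma res0CXn c m k :
  res0 (c ^+ m)%:P * ratX F ^+ k = res0 c%:P ^+ m * ratX F ^+ k.
Proof. by rewrite rmorphXn /= /res0 rmorphXn. Qed.

End ProjectiveLineSections.

Lemma revpZ (F : fieldType) d (c : F) a : revp d (c *: a) = c *: revp d a.
Proof.
by apply/polyP => i; rewrite coefZ !coef_revp coefZ; case: ifP; rewrite ?mulr0.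
Qed.

Lemma horner_revp (F : fieldType) d (a : {poly F}) (x : F) :
  (size a <= d.+1)%N -> x != 0 -> (revp d a).[x] = x ^+ d * a.[x^-1].
Proof.
move=> sa x0; rewrite (horner_coef_wide _ sa) horner_poly mulr_sumr.
rewrite (reindex_inj rev_ord_inj) /=; apply: eq_bigr => i _.
have id : (i <= d)%N by rewrite -ltnS.
rewrite subSS subKn // mulrCA; congr (_ * _).
by rewrite exprVn; apply: canRL (mulfK (expf_neq0 i x0)) _; rewrite -exprD subnK.
Qed.

Lemma map_revp (F K : fieldType) (phi : {rmorphism F -> K}) d a :
  map_poly phi (revp d a) = revp d (map_poly phi a).
Proof.
by apply/polyP => i; rewrite coef_map !coef_revp coef_map /=; case: ifP => // _; exact: rmorph0.
Qed.

(** A nonzero common root x of the reversals would give the common root 1/x of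
    the family, and the value of a reversal at 0 is the coefficient of degree
    d i. *)
Lemma revp_no_common_zero (F : fieldType) N (d : 'I_N.+1 -> nat) (a : 'I_N.+1 -> {poly F}) :
  (forall i, size (a i) <= (d i).+1)%N -> no_common_zero a ->
  (exists i, (a i)`_(d i) != 0) -> no_common_zero (fun i => revp (d i) (a i)).
Proof.
move=> sa a_nz [i ai] K phi x; have [->|x0] := eqVneq x 0.
  by exists i; rewrite horner_coef0 coef_map fmorph_eq0 coef_revp subn0.
have [j aj] := a_nz K phi x^-1; exists j.
by rewrite map_revp horner_revp ?size_map_poly // mulf_neq0 ?expf_neq0.
Qed.

(** * Counting the points of a quotient groupoid *)

(** Throughout, [pt] and [elt] are the two components of an equivalence from G to
    the action groupoid of gT on X: [elt] identifies the arrows from x to y with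
    the group elements that send [pt x] to [pt y].  Compatibility with
    composition is automatic for what is counted here. *)
Section QuotientGroupoid.
Variables (R : realType) (G : groupoid) (gT : finGroupType) (T : finType).
Variables (to : {action gT &-> T}) (X : {set T}).
Variables (pt : gob G -> T) (elt : gmor G -> gT).
Hypothesis actX : [acts [set: gT], on X | to].
Hypothesis pt_in : forall x, pt x \in X.
Hypothesis pt_surj : forall t, t \in X -> exists x, pt x = t.
Hypothesis elt_bij : forall x y,
  set_bij (ghom x y) [set u | to (pt x) u = pt y]%classic elt.

Let orb (t : T) := orbit to [set: gT] t.

Lemma iso_class_orbit x : iso_class x = [set y | pt y \in orb (pt x)]%classic.
Proof.
apply/seteqP; split=> y /=.
  move=> [f xyf]; have [fun_elt _ _] := elt_bij x y.
  by apply/imsetP; exists (elt f); rewrite ?inE // (fun_elt f).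
case/imsetP => u _ yu; have [_ _ sur] := elt_bij x y.
by have [f xyf _] := sur u (esym yu); exists f.
Qed.

(** Automorphisms correspond to the stabilizer, whose order is |gT| divided by
    the size of the orbit. *)
Lemma aut_weight_orbit x :
  aut_weight R x = #|orb (pt x)|%:R / #|gT|%:R.
Proof.
have [elt_fun elt_inj elt_sur] := elt_bij x x.
have autfin : finite_set (Defs.aut x).
  by rewrite -(eq_finite_set (inj_card_eq elt_inj)); exact: finite_finset.
pose S := ('C_[set: gT][pt x | to])%g.
have perm : perm_eq [seq elt f | f <- fset_set (Defs.aut x)] (enum S).
  apply: uniq_perm; rewrite ?enum_uniq //.
    rewrite map_inj_in_uniq ?fset_uniq // => f g.
    by rewrite !in_fset_set // => /set_mem fa /set_mem ga; apply: elt_inj; rewrite inE.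
  move=> u; rewrite mem_enum /S finset.setTI.
  apply/mapP/astab1P => [[f]|].
    by rewrite in_fset_set // => /set_mem /elt_fun + ->.
  by move=> /elt_sur[f fa <-]; exists f; rewrite // in_fset_set // inE.
have card_aut : #|` fset_set (Defs.aut x)| = #|S|.
  by rewrite cardE -(perm_size perm) size_map.
rewrite /aut_weight; case: pselect => [?|//] /=; rewrite card_aut.
rewrite -cardsT -(card_orbit_stab to [set: gT] (pt x)) natrM invfM mulrA mulfV ?mul1r //.
by rewrite pnatr_eq0 -lt0n; apply/card_gt0P; exists (pt x); exact: orbit_refl.
Qed.

Lemma class_weight_orbit t : t \in X ->
  class_weight R [set y | pt y \in orb t]%classic = #|orb t|%:R / #|gT|%:R.
Proof.
move=> tX; rewrite /class_weight; case: pselect => [C|]; last first.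
  by have [x <-] := pt_surj tX; case; exists x; exact: orbit_refl.
case: (cid C) => x /= xt; rewrite aut_weight_orbit; congr (#|pred_of_set _|%:R / _).
exact/orbit_eqP.
Qed.

(** Each orbit B contributes |B| / |gT|, and the orbits partition X. *)
Lemma weighted_count_quotient :
  weighted_count R G = (#|X|%:R / #|gT|%:R)%:E.
Proof.
pose e (B : {set T}) := [set y | pt y \in B]%classic : set (gob G).
pose orbs := [set orb t | t in X].
have classesE : iso_classes (G := G) = (e @` [set` enum orbs])%classic.
  apply/seteqP; split => C /=.
    move=> [x _ <-]; exists (orb (pt x)); last by rewrite iso_class_orbit.
    by rewrite mem_enum; apply/imsetP; exists (pt x); rewrite ?pt_in.
  move=> [B]; rewrite /= mem_enum => /imsetP[t tX ->] <-.
  by have [x <-] := pt_surj tX; exists x => //; rewrite iso_class_orbit.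
have e_inj : set_inj [set` enum orbs]%classic e.
  move=> B1 B2; rewrite !inE /= !mem_enum => /imsetP[t1 t1X ->] /imsetP[t2 t2X ->] E.
  apply/orbit_eqP; have [x xt] := pt_surj t1X.
  have : e (orb t1) x by rewrite /e /= xt; exact: orbit_refl.
  by rewrite E /e /= xt.
rewrite /weighted_count classesE esum_image // esum_fset; last 2 first.
- exact: finite_finpred.
- move=> B; rewrite inE /= mem_enum => /imsetP[t tX ->].
  by rewrite class_weight_orbit // lee_fin divr_ge0.
rewrite -fsbig_seq ?enum_uniq // big_enum /= sumEFin; congr (_%:E).
rewrite -(acts_sum_card_orbit actX) natr_sum mulr_suml; apply: eq_bigr => B.
by move=> /imsetP[t tX ->]; rewrite class_weight_orbit.
Qed.

End QuotientGroupoid.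

(** * The Hom stack as a quotient groupoid *)

Section HomStackAsQuotient.
Variables (F : finFieldType) (N : nat) (lam : 'I_N.+1 -> nat) (n : nat).
(* A common strict bound on all degrees n * lam i. *)
Local Notation D := (n * \sum_i lam i).+1.
Local Notation tup := {ffun 'I_N.+1 -> {poly_D F}}.

Local Notation deg i := (n * lam i)%N.

Lemma deg_lt i : (deg i < D)%N.
Proof. by rewrite ltnS leq_mul2l (bigD1 i) //= leq_addr orbT. Qed.

Definition scale_tuple (a : tup) (u : {unit F}) : tup :=
  [ffun i => val u ^+ lam i *: a i].

Lemma scale_tuple1 a : scale_tuple a 1%g = a.
Proof. by apply/ffunP => i; rewrite ffunE expr1n scale1r. Qed.

Lemma scale_tupleM a : act_morph scale_tuple a.
Proof.
move=> u v; apply/ffunP => i; rewrite !ffunE scalerA -exprMn.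
by rewrite mulrC.
Qed.

Canonical tuple_action := TotalAction scale_tuple1 scale_tupleM.

(** Leaving [bounded] by the degrees, while staying within it by the degrees
    plus one, means that some coordinate has the full degree n * lam i; then
    the coordinates have no common zero at infinity. *)
Definition hom_tuples : {set tup} :=
  coprime_bounded F D (fun i => (deg i).+1) :\: bounded F D (fun i => deg i).

Lemma hom_tuplesP (a : tup) : reflect
  [/\ forall i, (size (a i) <= (deg i).+1)%N,
      mgcd (fun i => val (a i)) = 1 &
      exists i, (val (a i))`_(deg i) != 0] (a \in hom_tuples).
Proof.
rewrite !inE; apply: (iffP and3P) => [[/forallPn[i ai] /forallP sa /eqP ga]|[sa ga [i ai]]].
  split => //; exists i; move: ai; rewrite -ltnNge => ai.
  have ei : size (a i) = (deg i).+1 by apply/eqP; rewrite eqn_leq sa ai.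
  have := lead_coef_eq0 (val (a i)); rewrite /lead_coef [size _]ei /= => ->.
  by rewrite -size_poly_eq0 [size _]ei.
split; first 1 last; [exact/forallP|exact/eqP|].
apply/forallPn; exists i; rewrite -ltnNge.
by apply: contraNltn ai => si; rewrite nth_default.
Qed.

Lemma unit_neq0 (u : {unit F}) : val u != 0.
Proof. by rewrite -unitfE; exact: valP u. Qed.

Lemma acts_hom_tuples : [acts [set: {unit F}], on hom_tuples | tuple_action].
Proof.
have act_in u a : a \in hom_tuples -> tuple_action a u \in hom_tuples.
  move=> /hom_tuplesP[sa ga [i ai]]; have u0 := unit_neq0 u.
  have sE j : val (tuple_action a u j) = val u ^+ lam j *: val (a j).
    by rewrite /= ffunE.
  apply/hom_tuplesP; split.
  - by move=> j; have /= -> := sE j; exact: leq_trans (size_scale_leq _ _) (sa j).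
  - rewrite -ga; apply: eqp_mgcd => j.
    by rewrite sE eqp_scale // expf_neq0.
  - by exists i; rewrite sE coefZ mulf_neq0 ?expf_neq0.
apply/actsP => u _ a; apply/idP/idP => [/(act_in (u^-1)%g)|]; last exact: act_in.
by rewrite actK.
Qed.

Definition coords (x : hom_point F lam n) : tup := [ffun i => npolyp D (Defs.coord0 x i)].

Lemma hom_point_section (x : hom_point F lam n) : exists2 c : F, c != 0 &
  transition (bundle x) = res0 c%:P * ratX F ^+ n /\
  forall i, (size (Defs.coord0 x i) <= (deg i).+1)%N /\
    Defs.coord1 x i = c^-1 ^+ lam i *: revp (deg i) (Defs.coord0 x i).
Proof.
have [c c0 E] := degree_transition (bundle_degree x); exists c => //; split => // i.
have := coord_glue x i; rewrite /is_section_pow E exprMn -exprM -res0CXn.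
move=> /(section_revp _ _ _ (expf_neq0 (lam i) c0))[sa ->].
by rewrite exprVn.
Qed.

Lemma coordsE x i : coords x i = Defs.coord0 x i :> {poly F}.
Proof.
rewrite ffunE npolypK //; have [c _ [_ /(_ i)[sa _]]] := hom_point_section x.
by rewrite (leq_trans sa) // deg_lt.
Qed.

(** Coprimality is the absence of a common zero on the first chart; the full
    degree of some coordinate comes from the origin of the second chart. *)
Lemma coords_in x : coords x \in hom_tuples.
Proof.
have [c c0 [_ xE]] := hom_point_section x; apply/hom_tuplesP; split.
- by move=> i; rewrite coordsE; case: (xE i).
- by rewrite (eq_mgcd (coordsE x)); apply/no_common_zeroP/(coord0_nz x).
have [i bi] := coord1_nz x [the {rmorphism F -> F} of idfun] 0; exists i.
rewrite -[val _]/(polyn _) coordsE; apply: contraNneq bi => ai.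
rewrite map_poly_id // horner_coef0 (xE i).2 coefZ coef_revp subn0 ai.
by rewrite mulr0.
Qed.

Lemma twist_regular : regular_on_overlap (ratX F ^+ n).
Proof. by exists 'X^n, 0%N; rewrite res0Xn expr0 divr1. Qed.

Lemma twistV_regular : regular_on_overlap (ratX F ^+ n)^-1.
Proof. by exists 1, n; rewrite /res0 rmorph1 mul1r. Qed.

(** O(n). *)
Definition twist_bundle : line_bundle F :=
  LineBundle (expf_neq0 n (ratX_neq0 F)) twist_regular twistV_regular.

Lemma twist_degree : has_degree twist_bundle n%:Z.
Proof.
exists 1, 1; rewrite hornerC oner_eq0; split => //=.
by rewrite /res0 rmorph1 divr1 mulr1.
Qed.

(** Every tuple is realized by sections of the powers of O(n). *)
Lemma coords_surj a : a \in hom_tuples -> exists x, coords x = a.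
Proof.
move=> /hom_tuplesP[sa ga ia].
have glue i : is_section_pow twist_bundle (lam i) (val (a i)) (revp (deg i) (val (a i))).
  rewrite /is_section_pow /= -exprM.
  have [_] := section_revp (deg i) (val (a i)) (revp (deg i) (val (a i))) (oner_neq0 F).
  rewrite /res0 rmorph1 mul1r; apply; split; [exact: sa | by rewrite invr1 scale1r].
have nz0 : no_common_zero (fun i => val (a i)) by apply/no_common_zeroP.
have nz1 := revp_no_common_zero sa nz0 ia.
exists (HomPoint twist_degree glue nz0 nz1); apply/ffunP => i; apply: val_inj.
by rewrite /= coordsE.
Qed.

(** An isomorphism acts on the first chart by a unit of F[t], that is, by a
    nonzero constant, which is extracted here; the value 1 is a default for
    pairs that are not isomorphisms. *)
Definition iso_unit (m : {poly F} * {poly F}) : {unit F} := insubd (1%g : {unit F}) m.1`_0.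

(** With transition functions c t^n and d t^n, the unit u on the first chart
    forces the unit c u / d on the second, and compatibility of the second
    coordinates then follows from [section_revp]. *)
Lemma iso_unit_bij (x y : hom_point F lam n) :
  set_bij (hom_iso x y) [set u | tuple_action (coords x) u = coords y]%classic iso_unit.
Proof.
have [c c0 [cE xE]] := hom_point_section x.
have [d d0 [dE yE]] := hom_point_section y.
have constP (p : {poly F}) : p \is a GRing.unit -> p = (p`_0)%:P.
  by rewrite poly_unitE => /andP[/eqP sp _]; apply: size1_polyC; rewrite sp.
have iso_unitE m : m.1 \is a GRing.unit -> m.1 = (val (iso_unit m))%:P.
  move=> um; rewrite val_insubd {1}(constP _ um); case: ifP => // /negP[].
  by move: um; rewrite poly_unitE => /andP[].
have iso2 m : hom_iso x y m -> m.2 = (d^-1 * c * val (iso_unit m))%:P.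
  case=> u1 u2 + _ _; rewrite cE dE (iso_unitE m u1) (constP _ u2) res1C.
  rewrite mulrA -res0M mulrAC -res0M => /(mulIf (expf_neq0 n (ratX_neq0 F))) /res0_inj.
  rewrite -!polyCM => /polyC_inj E.
  by congr _%:P; apply: (mulfI d0); rewrite -E -mulrA mulVKf // mulrC.
split.
- move=> m [u1 u2 _ E0 _] /=; apply/ffunP => i; apply: val_inj => /=.
  by rewrite ffunE /= !coordsE E0 (iso_unitE m u1) -rmorphXn mul_polyC.
- move=> m m'; rewrite !inE => Hm Hm' E; rewrite [m]surjective_pairing [m']surjective_pairing.
  rewrite (iso2 _ Hm) (iso2 _ Hm') E; case: Hm Hm' => u1 _ _ _ _ [u1' _ _ _ _].
  by rewrite (iso_unitE _ u1) (iso_unitE _ u1') E.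
move=> u /= uE; pose v := d^-1 * c * val u; have u0 := unit_neq0 u.
have v0 : v != 0 by rewrite !mulf_neq0 ?invr_eq0.
have E0 i : Defs.coord0 y i = val u ^+ lam i *: Defs.coord0 x i.
  by rewrite -!coordsE -uE ffunE.
exists ((val u)%:P, v%:P); last first.
  by apply: val_inj; rewrite val_insubd /= coefC /= unitfE u0.
split => /=.
- by rewrite poly_unitE size_polyC u0 coefC unitfE u0.
- by rewrite poly_unitE size_polyC v0 coefC unitfE v0.
- rewrite cE dE res1C mulrA -res0M mulrAC -res0M -!polyCM; congr (res0 _%:P * _).
  by rewrite /v -mulrA mulVKf // mulrC.
- by move=> i; rewrite E0 -rmorphXn mul_polyC.
move=> i; rewrite (xE i).2 (yE i).2 E0 -rmorphXn mul_polyC revpZ !scalerA; congr (_ *: _).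
rewrite -!exprMn; congr (_ ^+ _); rewrite /v; field; exact/andP.
Qed.

Lemma weighted_count_hom_stack (R : realType) :
  weighted_count R (Hom_stack_points F lam n) = (#|hom_tuples|%:R / (#|F|.-1)%:R)%:E.
Proof.
rewrite -card_finField_unit cardsT.
exact: (@weighted_count_quotient R (Hom_stack_points F lam n) _ _ tuple_action hom_tuples
  coords iso_unit acts_hom_tuples coords_in coords_surj iso_unit_bij).
Qed.

End HomStackAsQuotient.

(** * The point count *)

(** Here V + N + 1 is the sum of the degrees, as these are all positive.  Moving
    the negative terms of |X| to the other side keeps the identity in nat. *)
Lemma card_hom_tuples (F : finFieldType) N (lam : 'I_N.+1 -> nat) n
    (q := #|F|) (V := (\sum_i (n * lam i).-1)%N) :
  (forall i, 0 < lam i)%N -> (0 < n)%N ->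
  (#|hom_tuples F lam n| + q ^ (V + N.+1) + q ^ (V + N.+2) =
   q ^ (V + N.+1 + N.+1) + q ^ V.+1)%N.
Proof.
move=> lam0 n0; pose d i := (n * lam i)%N.
have d0 i : (0 < d i)%N by rewrite muln_gt0 n0 lam0.
have sumS (e : 'I_N.+1 -> nat) : (\sum_i (e i).+1 = \sum_i e i + N.+1)%N.
  under eq_bigr do rewrite -addn1.
  by rewrite big_split /= sum_nat_const card_ord muln1.
have sumd : (\sum_i d i = V + N.+1)%N.
  by rewrite /V -sumS; apply: eq_bigr => i _; rewrite prednK ?d0.
have q0 : (0 < q)%N by apply/card_gt0P; exists 0.
have leD i : (d i <= (n * \sum_i lam i).+1)%N by rewrite ltnW // deg_lt.
have := card_coprime_bounded F (deg_lt lam n); have := card_coprime_bounded F leD.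
rewrite sumS -/d sumd -/q -/V.
have -> : #|coprime_bounded F (n * \sum_i lam i).+1 (fun i => (d i).+1)| =
  (#|hom_tuples F lam n| + #|coprime_bounded F (n * \sum_i lam i).+1 d|)%N.
  rewrite -[LHS](cardsID (bounded F (n * \sum_i lam i).+1 d)) addnC; congr (_ + _)%N.
  apply: eq_card => a; rewrite !inE; case: eqP; rewrite ?andbF ?andbT //= => _.
  apply/andP/idP => [[]//|/forallP sa]; split; last exact/forallP.
  by apply/forallP => i; rewrite ltnW // ltnS sa.
have shift m : ((q ^ m).-1 * q + q = q ^ m.+1)%N.
  by rewrite addnC -mulSn prednK ?expn_gt0 ?q0 // expnSr.
have := shift V; have := shift (V + N.+1)%N; rewrite -addnS.
move: #|hom_tuples _ _ _| #|coprime_bounded _ _ d| (_ * q)%N (_ * q)%N => X M a b.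
by move: (q ^ _)%N (q ^ _)%N (q ^ _)%N (q ^ _)%N; lia.
Qed.

(** Multiplying by q^N shifts the geometric sum by N; the terms q^N of the shifted
    and the original sums cancel. *)
Lemma geometric_identity (R : fieldType) (q P : R) N :
  (\sum_(0 <= i < N.+1) q ^+ i) * (P * q ^+ N - P) =
  P * (\sum_(N.+1 <= i < (2 * N).+1) q ^+ i - \sum_(0 <= i < N) q ^+ i).
Proof.
have shift : q ^+ N * \sum_(0 <= i < N.+1) q ^+ i =
    q ^+ N + \sum_(N.+1 <= i < (2 * N).+1) q ^+ i.
  rewrite -big_ltn; last by lia.
  rewrite -[X in _ = \sum_(X <= _ < _) _]add0n big_addn mulr_sumr.
  rewrite (_ : (2 * N).+1 - N = N.+1)%N; last by lia.
  by apply: eq_bigr => i _; rewrite exprD mulrC.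
have recr : \sum_(0 <= i < N.+1) q ^+ i = \sum_(0 <= i < N) q ^+ i + q ^+ N.
  by rewrite big_nat_recr.
rewrite -[\sum_(N.+1 <= _ < _) _](addKr (q ^+ N)) -shift recr.
by ring.
Qed.

Theorem theorem1p4 (R : realType) (F : finFieldType) (N : nat)
    (lam : 'I_N.+1 -> nat) (n : nat)
    (lam_gt0 : forall i, (0 < lam i)%N)
    (lam_char : forall (p : nat) (i : 'I_N.+1),
       p \in [pchar F] -> ~~ (p %| lam i)%N)
    (n_ge1 : (1 <= n)%N) :
  let q : R := #|F|%:R in
  let w : nat := (\sum_(i < N.+1) lam i)%N in
  weighted_count R (Hom_stack_points F lam n) =
    ((\sum_(0 <= i < N.+1) q ^+ i) *
       (q ^+ (w * n) - q ^ ((w * n)%:Z - N%:Z)))%:E /\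
  (\sum_(0 <= i < N.+1) q ^+ i) *
      (q ^+ (w * n) - q ^ ((w * n)%:Z - N%:Z)) =
    q ^ ((w * n)%:Z - N%:Z) *
      (\sum_(N.+1 <= i < (2 * N).+1) q ^+ i - \sum_(0 <= i < N) q ^+ i).
Proof.
move=> q w; pose V := (\sum_i (n * lam i).-1)%N.
have wn : (w * n = V.+1 + N)%N.
  rewrite mulnC /w big_distrr /=.
  transitivity (\sum_i ((n * lam i).-1 + 1))%N.
    by apply: eq_bigr => i _; rewrite addn1 prednK // muln_gt0 n_ge1 lam_gt0.
  by rewrite big_split /= sum_nat_const card_ord muln1 addSnnS.
have F1 : (1 < #|F|)%N by exact: finNzRing_gt1.
have q1 : q - 1 != 0 by rewrite subr_eq0 pnatr_eq1 gtn_eqF.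
have qV : q ^ ((w * n)%:Z - N%:Z) = q ^+ V.+1.
  by rewrite wn PoszD addrK.
have qwn : q ^+ (w * n) = q ^+ V.+1 * q ^+ N by rewrite wn exprD.
split; last by rewrite qV qwn; exact: geometric_identity.
rewrite qV qwn weighted_count_hom_stack; congr (_%:E).
have := congr1 (fun m => m%:R : R) (card_hom_tuples F lam_gt0 n_ge1).
rewrite -/V !natrD !natrX -/q !(exprD, exprS) => E.
rewrite -subn1 natrB ?(ltnW F1) // -/q.
apply: (canLR (mulfK q1)).
have S : (q - 1) * (\sum_(0 <= i < N.+1) q ^+ i) = q * q ^+ N - 1.
  by rewrite big_mkord -subrX1 exprS.
rewrite mulrAC [_ * (q - 1)]mulrC S.
apply: (addIr (q ^+ V * (q * q ^+ N))); apply: (addIr (q ^+ V * (q * (q * q ^+ N)))).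
by rewrite E; ring.
Qed.
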